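(* Let $\varepsilon > 0$ be arbitrary. If $A = \{a_1, a_2, \dots\} \subset \mathbb{N}$ is an infinite set with $0 \le a_1 < a_2 < \cdots$ such that $$|a_n - n^2| = O\Big(e^{(\log 2 - \varepsilon)\frac{\log n}{\log\log n}}\Big) \quad (n \to \infty),$$ then the function $R_A(n)$ is not bounded.
   Context: $\mathbb{N}$ denotes the set of nonnegative integers. For an infinite set $A = \{a_1 < a_2 < \cdots\} \subset \mathbb{N}$ and $n \in \mathbb{N}$, $R_A(n)$ is the number of pairs $(i,j)$ with $i \le j$ and $a_i + a_j = n$. $\log$ is the natural logarithm. *)

(* Defs.v *)
From HB Require Import structures.
From mathcomp Require Import all_boot all_order all_algebra finmap.
From mathcomp Require Import all_classical all_reals all_analysis.

Set Implicit Arguments.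
Unset Strict Implicit.
Unset Printing Implicit Defensive.

Import Order.TTheory GRing.Theory Num.Theory.
Import numFieldNormedType.Exports.

Local Open Scope classical_set_scope.
Local Open Scope nat_scope.

(* An infinite set A = {a_1 < a_2 < ...} of natural numbers is given by its
   increasing enumeration [a]. Indices start at 1: the value [a 0] is never
   used. *)
Definition increasing_enum (a : nat -> nat) : Prop :=
  forall i j : nat, 1 <= i -> i < j -> a i < a j.

Definition rep_pairs (a : nat -> nat) (n : nat) : set (nat * nat) :=
  [set p | [/\ 1 <= p.1, p.1 <= p.2 & a p.1 + a p.2 = n]].

(* [fset_set] sends infinite sets to [fset0]; [finite_rep_pairs] below shows
   that this case does not occur for an increasing enumeration. *)
Definition rep_count (a : nat -> nat) (n : nat) : nat :=
  #|` fset_set (rep_pairs a n)|.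

Lemma increasing_enum_ge (a : nat -> nat) (i : nat) :
  increasing_enum a -> i <= a i.+1.
Proof.
move=> ha; elim: i => [//|i IHi].
by apply: (leq_ltn_trans IHi); apply: ha.
Qed.

Lemma finite_rep_pairs (a : nat -> nat) (n : nat) :
  increasing_enum a -> finite_set (rep_pairs a n).
Proof.
move=> ha; apply: (@sub_finite_set _ _ (`I_n.+2 `*` `I_n.+2)); last first.
  by apply: finite_setX; apply: finite_II.
have bnd i : 1 <= i -> a i <= n -> i < n.+2.
  case: i => [//|i] _ hi.
  by rewrite !ltnS; apply: leq_trans hi; apply: increasing_enum_ge.
move=> [i j] [/= i1 ij sum_n]; split => /=; apply: bnd => //.
- by rewrite -sum_n leq_addr.
- exact: leq_trans ij.
- by rewrite -sum_n leq_addl.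
Qed.

(* Main.v *)
Require Import Defs.
From mathcomp Require Import all_boot all_order all_algebra finmap.
From mathcomp Require Import all_classical all_reals all_analysis.
From mathcomp Require Import zify ring lra.
Import Order.TTheory GRing.Theory Num.Theory.
Import numFieldNormedType.Exports.

(** Some integers N have so many representations i^2 + j^2 = N that replacing
    every square by a nearby element of A cannot spread the sums out enough.
    If N is a product of k distinct odd primes that are sums of two squares,
    then, in the Gaussian integers, each prime offers a choice between two
    conjugate factors, and the 2^k resulting products are distinct
    ([many_signed_reps]). Let D bound |a_i - i^2| for all i <= sqrt N. For each
    representation, a_i + a_j lies within 2 D of N, so the pigeonhole principle
    puts about 2^k / (8 (4 D + 1)) representations on one and the same sum
    ([exists_large_rep_count]; the 8 accounts for signs and for the order of i
    and j).

    It remains to compare D with 2^k. With t = log i, the hypothesis bounds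
    |a_i - i^2| by a constant times exp((log 2 - eps) t / log t), and t / log t
    increases, so t may be replaced by an upper bound T of (log N) / 2. If the
    primes are at most y, one can take T = k (log y) / 2. If moreover
    k >= y^(1/2 - o(1)), then log T is asymptotically at least (log y) / 2, so
    T / log T <= (1 + o(1)) k and D = O(exp((log 2 - eps / 2) k)), which is
    smaller than 2^k by an exponential factor. The logarithm is halved because i
    is at most sqrt N; this is why about sqrt y primes up to y are enough.

    Such primes are the prime factors of P = prod_(1 <= b <= x) (4 b^2 + 1),
    with y = 4 x^2 + 1. A congruence 4 b^2 + 1 = 0 has at most two roots modulo
    an odd prime power, so the exponent of p in P exceeds twice the exponent
    of p in x! by at most 2 log_p y. Hence
    4^x (x!)^2 <= P <= (x!)^2 y^(2 k), that is, 2^x <= y^k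
    ([prime_factors_squares_plus_one]): P has at least a constant times
    x / log x distinct prime factors. *)

Set Implicit Arguments.
Unset Strict Implicit.
Unset Printing Implicit Defensive.

Local Open Scope nat_scope.

(** * Prime factors of the values 4 b^2 + 1 *)

(** The coefficient 4 makes all prime factors odd, which the distinctness of the
    representations relies on. *)
Definition squares_plus_one (x : nat) : nat :=
  \prod_(1 <= b < x.+1) (4 * b ^ 2 + 1).

Lemma sum_nat_residue_le (q r x : nat) : 0 < q ->
  \sum_(1 <= b < x.+1) (b == r %[mod q]) <= x %/ q + 1.
Proof.
move=> q_gt0.
(* With r' the representative of r in [1, q], the sum is exactly
   (x + q - r') / q; the induction needs this sharper form. *)
pose r' := if q %| r then q else r %% q.
have step m : \sum_(1 <= b < m.+1) (b == r %[mod q]) <= (m + (q - r')) %/ q.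
  elim: m => [|m IHm]; first by rewrite big_geq.
  rewrite big_nat_recr //=; have [eqr|_] := eqVneq; last first.
    by rewrite addn0 (leq_trans IHm) // leq_div2r // leq_add2r.
  apply: leq_trans (leq_add IHm (leqnn _)) _.
  have r'_le : r' <= q.
    by rewrite /r'; case: ifP => // _; apply/ltnW/ltn_pmod.
  have r'_gt0 : 0 < r'.
    by rewrite /r'; case: ifP => //; rewrite lt0n /dvdn => ->.
  have : q %| m.+1 + (q - r').
    rewrite /r'; case: ifP => [qr|_].
      by rewrite subnn addn0 /dvdn eqr.
    rewrite /dvdn -modnDml eqr subnKC ?modnn //; exact/ltnW/ltn_pmod.
  case/dvdnP=> t Et; rewrite Et mulnK // addn1.
  rewrite ltn_divLR //; lia.
apply: leq_trans (step x) _.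
rewrite addnC [X in _ <= X]addnC -(divnMDl 1 _ q_gt0) mul1n.
by rewrite leq_div2r // leq_add2r leq_subr.
Qed.

(** The prime p divides 4 (b - c) (b + c), but not both factors, since p is odd
    and prime to c; so the whole power p^j divides one of them. *)
Lemma dvdn_add_of_roots (p j b c : nat) : prime p -> 0 < j ->
  p ^ j %| 4 * b ^ 2 + 1 -> p ^ j %| 4 * c ^ 2 + 1 ->
  (b == c %[mod p ^ j]) || (p ^ j %| b + c).
Proof.
wlog lcb : b c / c <= b.
  move=> H p_pr j_gt0 qb qc; have [lcb|/ltnW lbc] := leqP c b; first exact: H.
  by rewrite eq_sym addnC; apply: H.
move=> p_pr j_gt0 qb qc; set q := p ^ j in qb qc *.
have pq : p %| q by rewrite dvdn_exp.
have p_odd : odd p.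
  have: odd (4 * c ^ 2 + 1) by rewrite addn1 /= oddM.
  by case/dvdnP: (dvdn_trans pq qc) => t ->; rewrite oddM => /andP[].
have cop2 : coprime p 2.
  by rewrite prime_coprime // dvdn_prime2 //; apply: contraL p_odd => /eqP ->.
have npc : ~~ (p %| c).
  apply/negP => pc; have := dvdn_trans pq qc; rewrite dvdn_addr.
    by rewrite dvdn1 => /eqP E; rewrite E in p_pr.
  by rewrite dvdn_mull // dvdn_exp.
have : q %| 4 * ((b + c) * (b - c)).
  have -> : 4 * ((b + c) * (b - c)) = (4 * b ^ 2 + 1) - (4 * c ^ 2 + 1).
    by rewrite subnDr -mulnBr subn_sqr [(b - c) * _]mulnC.
  exact: dvdn_sub.
rewrite Gauss_dvdr; last by rewrite coprimeXl // (_ : 4 = 2 ^ 2) // coprimeXr.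
rewrite eqn_mod_dvd //.
have [pbc|npbc] := boolP (p %| b + c) => qq; apply/orP; [right|left].
  rewrite -(@Gauss_dvdl _ _ (b - c)) // coprimeXl // prime_coprime //.
  apply/negP => pbc'; have := dvdn_sub pbc pbc'.
  have -> : b + c - (b - c) = 2 * c by clear -lcb; lia.
  by rewrite Gauss_dvdr // (negbTE npc).
by rewrite -(@Gauss_dvdr _ (b + c)) // coprimeXl // prime_coprime.
Qed.

Lemma sum_nat_root_le (p j x : nat) : prime p -> 0 < j ->
  \sum_(1 <= b < x.+1) (p ^ j %| 4 * b ^ 2 + 1) <= 2 * (x %/ p ^ j) + 2.
Proof.
move=> p_pr j_gt0; have q_gt0 : 0 < p ^ j by rewrite expn_gt0 prime_gt0.
have [/hasP[c _ qc]|/hasPn none] :=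
    boolP (has (fun b => p ^ j %| 4 * b ^ 2 + 1) (index_iota 1 x.+1));
    last first.
  by rewrite big1_seq // => b /andP[_ /none /negbTE ->].
have H r := sum_nat_residue_le r x q_gt0.
rewrite (_ : 2 * _ + 2 = x %/ p ^ j + 1 + (x %/ p ^ j + 1)); last by lia.
apply: leq_trans (leq_add (H c) (H (c * (p ^ j).-1))).
rewrite -big_split /=; apply: leq_sum => b _.
case: (boolP (_ %| _)) => //= qb.
(* c (q - 1) is the class of - c modulo q = p^j. *)
rewrite -(eqn_modDr c b (c * _)).
rewrite -mulnSr prednK // modnMl.
have /orP[->|] := dvdn_add_of_roots p_pr j_gt0 qb qc.
  by rewrite add1n.
by rewrite /dvdn => ->; rewrite addn1.
Qed.

(** Each power p^j <= 4 x^2 + 1 divides at most 2 floor(x / p^j) + 2 of the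
    factors, and the exponent of p in x! is the sum of the floor(x / p^j). *)
Lemma logn_squares_plus_one (p x : nat) : prime p ->
  logn p (squares_plus_one x)
    <= 2 * logn p x`! + 2 * trunc_log p (4 * x ^ 2 + 1).
Proof.
move=> p_pr; set L := trunc_log p _.
have p_gt1 := prime_gt1 p_pr.
have logE b : 1 <= b < x.+1 ->
    logn p (4 * b ^ 2 + 1) = \sum_(1 <= j < L.+1) (p ^ j %| 4 * b ^ 2 + 1).
  move=> /andP[b_gt0 b_le].
  have lL : logn p (4 * b ^ 2 + 1) <= L.
    apply: trunc_log_max => //; apply: leq_trans (_ : 4 * b ^ 2 + 1 <= _).
      by rewrite dvdn_leq ?pfactor_dvdnn // addn1.
    by rewrite leq_add2r leq_mul2l leq_exp2r.
  under eq_bigr do rewrite pfactor_dvdn ?addn1 // -addn1.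
  rewrite (big_cat_nat (n := (logn p (4 * b ^ 2 + 1)).+1)) //=.
  rewrite (eq_big_nat _ _ (F2 := fun=> 1)); last first.
    by move=> i /andP[_]; rewrite ltnS => ->.
  rewrite sum_nat_const_nat muln1 subSS subn0 big_nat big1 ?addn0 //.
  by move=> i /andP[]; rewrite ltnNge => /negbTE ->.
rewrite /squares_plus_one.
have -> : logn p (\prod_(1 <= b < x.+1) (4 * b ^ 2 + 1)) =
    \sum_(1 <= b < x.+1) logn p (4 * b ^ 2 + 1).
  elim: x.+1 => [|m IHm]; first by rewrite !big_geq // logn1.
  case: m IHm => [|m] IHm; first by rewrite !big_geq // logn1.
  rewrite big_nat_recr // [RHS]big_nat_recr // -IHm /= lognM ?addn1 //.
  by apply: prodn_gt0 => b; rewrite addn1.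
rewrite (eq_big_nat _ _ logE) exchange_big_nat /=.
rewrite logn_fact //.
apply: (@leq_trans (\sum_(1 <= j < L.+1) (2 * (x %/ p ^ j) + 2))).
  rewrite [leqLHS]big_nat [leqRHS]big_nat.
  by apply: leq_sum => j /andP[j_gt0 _]; apply: sum_nat_root_le.
rewrite big_split /= sum_nat_const_nat subSS subn0 [L * 2]mulnC leq_add2r.
rewrite -big_distrr leq_mul2l /=.
case: (leqP L x) => [Lx|/ltnW xL].
  by rewrite [leqRHS](big_cat_nat (n := L.+1)) //= leq_addr.
rewrite (big_cat_nat (n := x.+1)) //= -[leqRHS]addn0 leq_add2l big_nat.
rewrite big1 // => j /andP[xj _].
by rewrite divn_small // (ltn_trans xj) // ltn_expl.
Qed.

Lemma squares_plus_one_gt0 x : 0 < squares_plus_one x.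
Proof. by apply: prodn_gt0 => b; rewrite addn1. Qed.

Lemma fact_sq_le_squares_plus_one x : 4 ^ x * x`! ^ 2 <= squares_plus_one x.
Proof.
elim: x => [|x IHx]; first by rewrite /squares_plus_one big_geq.
rewrite /squares_plus_one big_nat_recr //= factS expnS.
apply: leq_trans (leq_mul IHx (leqnn _)).
by nia.
Qed.

(** The part of x! built from the primes dividing P is at most x!, so the
    factorials cancel and only the contribution y^2 of each prime remains. *)
Lemma prime_factors_squares_plus_one x :
  2 ^ x <= (4 * x ^ 2 + 1) ^ size (primes (squares_plus_one x)).
Proof.
set P := squares_plus_one x; set y := _ + 1; set k := size _.
have P_gt0 : 0 < P := squares_plus_one_gt0 x.
have le_P : P <= (x`! * y ^ k) ^ 2.
  pose m := maxn P x`!.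
  rewrite -[leqLHS](partn_pi P_gt0) (widen_partn (m := m)) ?leq_maxl //.
  apply: (@leq_trans
    (\prod_(0 <= p < m.+1 | p \in \pi(P)) (p ^ logn p x`! * y) ^ 2)).
    apply: leq_prod => p; rewrite mem_primes => /and3P[p_pr _ _].
    apply: leq_trans
      (leq_pexp2l (prime_gt0 p_pr) (logn_squares_plus_one x p_pr)) _.
    rewrite -mulnDr mulnC expnM leq_exp2r // expnD leq_mul2l.
    by rewrite trunc_logP ?orbT ?prime_gt1 // /y addn1.
  under eq_bigr do rewrite -mulnn.
  rewrite big_split /= mulnn leq_exp2r // big_split /=.
  rewrite -(widen_partn _ (leq_maxr P x`!)).
  apply: leq_mul; first by rewrite dvdn_leq ?dvdn_part ?fact_gt0.
  rewrite big_const_seq iter_muln_1 leq_pexp2l //; first by rewrite /y addn1.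
  rewrite -size_filter /k; apply: uniq_leq_size.
    by rewrite filter_uniq // iota_uniq.
  by move=> p; rewrite mem_filter => /andP[].
have := leq_trans (fact_sq_le_squares_plus_one x) le_P.
rewrite (_ : 4 = 2 ^ 2) // -expnM [2 * x]mulnC expnM -expnMn leq_exp2r // mulnC.
by rewrite leq_pmul2l ?fact_gt0.
Qed.

(** * Sums of two squares and Gaussian integers *)

Lemma prime_not_square (p m : nat) : prime p -> m ^ 2 != p.
Proof.
move=> p_pr; apply/eqP => E; have := logn_prime p p_pr.
rewrite eqxx -[X in logn _ X]E lognX; lia.
Qed.

Local Open Scope ring_scope.

(** Pairs stand for Gaussian integers: [sum_sq] is the norm, [gmul] the product
    and [gconj] the conjugation. *)
Definition sum_sq (z : int * int) : int := z.1 ^+ 2 + z.2 ^+ 2.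
Definition gmul (c z : int * int) : int * int :=
  (c.1 * z.1 - c.2 * z.2, c.1 * z.2 + c.2 * z.1).
Definition gconj (c : int * int) : int * int := (c.1, - c.2).

(** Thue's argument: with m = floor(sqrt p), the (m + 1)^2 > p values x + s y,
    0 <= x, y <= m, cannot be distinct modulo p; the difference (dx, dy) of two
    pairs with the same value has norm divisible by p and strictly between 0
    and 2 p. *)
Lemma prime_sum_two_squares (p s : nat) : prime p -> (p %| s ^ 2 + 1)%N ->
  exists c : int * int, sum_sq c = p%:Z.
Proof.
move=> p_pr /dvdnP[w /(congr1 Posz)]; rewrite -mulnn PoszD !PoszM => Ew.
have p_gt0 := prime_gt0 p_pr.
have [m [m_lt m_gt]] : exists m, (m ^ 2 < p)%N /\ (p < m.+1 ^ 2)%N.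
  have bnd i : (i ^ 2 <= p -> i <= p)%N.
    by move=> le_p; apply: leq_trans le_p; nia.
  have ex : exists i, (i ^ 2 <= p)%N by exists 0%N.
  have [m m_le m_max] := ex_maxnP ex bnd.
  exists m; rewrite ltn_neqAle prime_not_square // m_le; split=> //.
  rewrite ltn_neqAle eq_sym prime_not_square //= leqNgt.
  by apply/negP => /ltnW/m_max; rewrite ltnn.
pose f (xy : 'I_m.+1 * 'I_m.+1) := Ordinal (ltn_pmod (xy.1 + s * xy.2) p_gt0).
have /injectivePn[[x y] [[x' y'] ne /(congr1 val)/= eq_mod]] : ~~ injectiveb f.
  apply: contraL m_gt => /injectiveP/leq_card.
  by rewrite card_prod !card_ord -leqNgt mulnn.
have /dvdzP[t Et] : (p %| (x%:Z + s%:Z * y%:Z) - (x'%:Z + s%:Z * y'%:Z))%Z.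
  by rewrite -eqz_mod_dvd -!PoszM -!PoszD !modz_nat eq_mod.
pose dx : int := x%:Z - x'%:Z; pose dy : int := y%:Z - y'%:Z.
exists (dx, dy); rewrite /sum_sq /=.
have [q Eq] : exists q, dx ^+ 2 + dy ^+ 2 = p%:Z * q.
  exists (t ^+ 2 * p%:Z - 2 * t * s%:Z * dy + w%:Z * dy ^+ 2).
  have -> : dx = t * p%:Z - s%:Z * dy by rewrite -Et /dx /dy; ring.
  have -> : p%:Z * (t ^+ 2 * p%:Z - 2 * t * s%:Z * dy + w%:Z * dy ^+ 2) =
    t ^+ 2 * p%:Z ^+ 2 - 2 * t * s%:Z * dy * p%:Z + w%:Z * p%:Z * dy ^+ 2.
    by ring.
  by rewrite -Ew; ring.
have nz : (dx != 0) || (dy != 0).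
  apply: contraNT ne; rewrite negb_or !negbK !subr_eq0.
  move=> /andP[/eqP[Ex] /eqP[Ey]].
  by apply/eqP; congr (_, _); apply: val_inj.
have sq_le (i j : 'I_m.+1) : (i%:Z - j%:Z) ^+ 2 < p%:Z.
  have := ltn_ord i; have := ltn_ord j; move: m_lt; clear; nia.
have := sq_le x x'; have := sq_le y y'; rewrite -/dx -/dy => lt1 lt2.
have gt0 : 0 < dx ^+ 2 + dy ^+ 2.
  by case/orP: nz => nz; [apply: ltr_wpDr|apply: ltr_wpDl];
    rewrite ?sqr_ge0 // exprn_even_gt0 //= nz.
have : q = 1 by move: (p_gt0) (Eq) lt1 lt2 gt0; clear; nia.
by move=> q1; rewrite Eq q1 mulr1.
Qed.

Lemma sum_sq_gmul c z : sum_sq (gmul c z) = sum_sq c * sum_sq z.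
Proof. rewrite /sum_sq /gmul /=; ring. Qed.

Lemma sum_sq_gconj c : sum_sq (gconj c) = sum_sq c.
Proof. by rewrite /sum_sq /= sqrrN. Qed.

Lemma gmulK c z : gmul (gconj c) (gmul c z) = (sum_sq c * z.1, sum_sq c * z.2).
Proof. rewrite /sum_sq /gmul /=; congr (_, _); ring. Qed.

Lemma gmul_inj c : sum_sq c != 0 -> injective (gmul c).
Proof.
move=> nz z z' /(congr1 (gmul (gconj c))).
rewrite !gmulK => -[/(mulfI nz) E1 /(mulfI nz) E2].
by case: z z' E1 E2 => [? ?] [? ?] /= -> ->.
Qed.

(** Multiplying c z = conj(c) z' by c gives c^2 z = p z'. As p is odd and does
    not divide the real part of c, its real part shows that p divides the real
    part of c z; then p also divides the imaginary part, so p^2 divides the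
    norm p * sum_sq z of c z. *)
Lemma gmul_neq_gmul_conj (p : nat) (c z z' : int * int) :
  prime p -> odd p -> sum_sq c = p%:Z -> ~~ (p %| sum_sq z)%Z ->
  gmul c z != gmul (gconj c) z'.
Proof.
move=> p_pr p_odd Ec; apply: contraNneq => E.
case: c Ec E => a b; rewrite /sum_sq /gmul /gconj /= => Ec [E1 E2].
have euclid (x y : int) : (p %| x * y)%Z -> (p %| x)%Z || (p %| y)%Z.
  by rewrite !dvdzE abszM Euclid_dvdM.
have sq_dvd (x y : int) :
    (p %| x)%Z -> (p %| y)%Z -> (p%:Z * p %| x ^+ 2 + y ^+ 2)%Z.
  by move=> px py; rewrite rpredD // expr2 dvdz_mul.
have sq_dvd_r (x y : int) :
    (p %| x)%Z -> (p %| x ^+ 2 + y ^+ 2)%Z -> (p %| y)%Z.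
  move=> px; rewrite rpredDl; last by rewrite expr2 [_ \in _]dvdz_mulr.
  by rewrite expr2 => /euclid; rewrite orbb.
have p_neq0 : p%:Z != 0 by have := prime_gt0 p_pr; lia.
have npa : ~~ (p %| a)%Z.
  apply/negP => pa; have pb : (p %| b)%Z by rewrite (sq_dvd_r a) // Ec.
  have := sq_dvd _ _ pa pb; rewrite Ec -[X in (_ %| X)%Z]mulr1 dvdz_mul2l //.
  by rewrite dvdzE dvdn1 /= => /eqP p1; rewrite p1 in p_pr.
have pX : (p %| a * z.1 - b * z.2)%Z.
  have : (p %| 2 * (a * (a * z.1 - b * z.2)))%Z.
    apply/dvdzP; exists (z'.1 + z.1); rewrite -Ec.
    have H : a * (a * z.1 - b * z.2) - b * (a * z.2 + b * z.1)
        = (a ^+ 2 + b ^+ 2) * z'.1.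
      by rewrite E1 E2; ring.
    rewrite [RHS](_ : _ = (a ^+ 2 + b ^+ 2) * z'.1 + (a ^+ 2 + b ^+ 2) * z.1);
      last by ring.
    by rewrite -H; ring.
  case/euclid/orP.
    by rewrite dvdzE /= dvdn_prime2 // => /eqP p2; rewrite p2 in p_odd.
  by case/euclid/orP => // pa; rewrite pa in npa.
have sumXY : (a * z.1 - b * z.2) ^+ 2 + (a * z.2 + b * z.1) ^+ 2
    = p%:Z * (z.1 ^+ 2 + z.2 ^+ 2) by rewrite -Ec; ring.
have pY : (p %| a * z.2 + b * z.1)%Z.
  by apply: sq_dvd_r pX _; rewrite sumXY dvdz_mulr.
by have := sq_dvd _ _ pX pY; rewrite sumXY dvdz_mul2l.
Qed.

(** If c has norm p, then z |-> c z and z |-> conj(c) z send the elements of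
    norm N injectively to elements of norm p N, with disjoint images when p
    does not divide N; so each new prime doubles the list. *)
Lemma many_signed_reps (ps : seq nat) : uniq ps ->
  {in ps, forall p, [/\ prime p, odd p & exists c, sum_sq c = p%:Z]} ->
  exists l : seq (int * int), [/\ uniq l, size l = (2 ^ size ps)%N
    & {in l, forall z, sum_sq z = (\prod_(p <- ps) p)%N%:Z}].
Proof.
elim: ps => [|p ps IHps] /=.
  move=> _ _; exists [:: (1, 0)]; split=> // z.
  by rewrite inE => /eqP ->; rewrite big_nil.
move=> /andP[p_notin ps_uniq] Hps.
have [|l [l_uniq l_size l_sum]] := IHps ps_uniq.
  by move=> q q_in; apply: Hps; rewrite inE q_in orbT.
have [p_pr p_odd [c Ec]] := Hps p (mem_head _ _).
have nz_c : sum_sq c != 0 by rewrite Ec; have := prime_gt0 p_pr; lia.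
exists (map (gmul c) l ++ map (gmul (gconj c)) l); split.
- rewrite cat_uniq !map_inj_uniq ?l_uniq ?andbT //=;
    try by apply: gmul_inj; rewrite ?sum_sq_gconj.
  apply/hasPn => _ /mapP[z' z'_in ->]; apply/mapP => -[z z_in /esym/eqP].
  apply/negP.
  apply: (gmul_neq_gmul_conj _ p_pr p_odd Ec).
  rewrite l_sum // dvdzE /= Euclid_dvd_prod // big_has.
  apply/hasPn => q q_in; rewrite dvdn_prime2 //; last first.
    by have [] := Hps q; rewrite ?inE ?q_in ?orbT.
  by apply: contraNneq p_notin => ->.
- by rewrite size_cat !size_map l_size expnS mul2n addnn.
- move=> _ /[!mem_cat] /orP[] /mapP[z z_in ->].
  all: by rewrite sum_sq_gmul ?sum_sq_gconj Ec l_sum // big_cons PoszM.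
Qed.

Local Open Scope classical_set_scope.
Local Open Scope ring_scope.

Lemma prod_primes_not_square (ps : seq nat) (v : nat) : uniq ps -> ps != [::] ->
  {in ps, forall p, prime p} -> (v ^ 2 != \prod_(p <- ps) p)%N.
Proof.
case: ps => [//|p ps] /= /andP[p_notin _] _ Hps; rewrite big_cons.
have p_pr : prime p by apply: Hps; rewrite mem_head.
apply/eqP => E; have pv : (p %| v)%N.
  have := dvdn_mulr (\prod_(q <- ps) q) (dvdnn p).
  by rewrite -E Euclid_dvdX // andbT.
have : (p * p %| p * \prod_(q <- ps) q)%N by rewrite -E -mulnn dvdn_mul.
rewrite dvdn_pmul2l ?prime_gt0 // Euclid_dvd_prod // big_has => /hasP[q q_in].
rewrite dvdn_prime2 //; last by apply: Hps; rewrite inE q_in orbT.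
by move/eqP => pq; rewrite pq q_in in p_notin.
Qed.

Lemma prime_factor_squares_plus_one (p x : nat) :
  p \in primes (squares_plus_one x) ->
  [/\ prime p, odd p, (p <= 4 * x ^ 2 + 1)%N & exists c, sum_sq c = p%:Z].
Proof.
rewrite mem_primes => /and3P[p_pr _].
rewrite Euclid_dvd_prod // big_has => /hasP[b].
rewrite mem_index_iota ltnS => /andP[_ b_le] pb; split=> //.
- have : odd (4 * b ^ 2 + 1) by rewrite addn1 /= oddM.
  by case/dvdnP: pb => t ->; rewrite oddM => /andP[].
- apply: leq_trans (dvdn_leq _ pb) _; first by rewrite addn1.
  by rewrite leq_add2r leq_mul2l leq_exp2r.
- by apply: (@prime_sum_two_squares p (2 * b)); rewrite // expnMn.
Qed.

(** N is the product of the prime factors of [squares_plus_one x]. It is not a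
    square, so no representation involves the index 0, at which an enumeration
    has no meaning. *)
Lemma number_with_many_signed_reps (x : nat) : (0 < x)%N ->
  exists k N (l : seq (int * int)),
   [/\ (2 ^ x <= (4 * x ^ 2 + 1) ^ k)%N, (N <= (4 * x ^ 2 + 1) ^ k)%N,
       forall v, (v ^ 2 != N)%N, uniq l & size l = (2 ^ k)%N
       /\ {in l, forall z, sum_sq z = N%:Z}].
Proof.
move=> x_gt0; pose ps := primes (squares_plus_one x).
have facts := @prime_factor_squares_plus_one ^~ x.
have le_pow := prime_factors_squares_plus_one x.
have [||l [l_uniq l_size l_sum]] := @many_signed_reps ps.
- exact: primes_uniq.
- by move=> p /facts[].
exists (size ps), (\prod_(p <- ps) p)%N, l; split=> //.
- have : {in ps, forall p, (p <= 4 * x ^ 2 + 1)%N} by move=> p /facts[].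
  elim: (ps) => [|p qs IHqs] le_y; first by rewrite big_nil.
  rewrite big_cons /= expnS leq_mul ?le_y ?mem_head //.
  by apply: IHqs => q q_in; apply: le_y; rewrite inE q_in orbT.
- move=> v; apply: prod_primes_not_square; first exact: primes_uniq.
    apply: contraTneq le_pow; rewrite -/ps => ->.
    by rewrite -ltnNge /= expn0 -(expn0 2) ltn_exp2l.
  by move=> p /facts[].
Qed.

(** * From many representations to a popular sum *)

Lemma pigeonhole_seq (T : eqType) (K : finType) (f : T -> K) (s : seq T)
    (m : nat) :
  (#|K| * m < size s)%N -> exists c, (m < count (fun z => f z == c) s)%N.
Proof.
move=> lt_size; apply/existsP; apply: contraLR lt_size.
rewrite negb_exists => /forallP le_m; rewrite -leqNgt.
have -> : size s = (\sum_(c : K) count (fun z => f z == c) s)%N.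
  elim: s {le_m} => [|z s IHs] /=; first by rewrite big1.
  rewrite big_split /= -IHs (bigD1 (f z)) //= eqxx big1 ?addn0 ?add1n // => c.
  by rewrite eq_sym => /negbTE ->.
rewrite -sum_nat_const; apply: leq_sum => c _; by rewrite leqNgt le_m.
Qed.

Lemma rep_count_ge (a : nat -> nat) (n : nat) (s : seq (nat * nat)) :
  increasing_enum a -> uniq s -> {in s, forall p, rep_pairs a n p} ->
  (size s <= rep_count a n)%N.
Proof.
move=> a_incr s_uniq s_sub.
rewrite -(undup_id s_uniq) -card_fseq; apply/fsubset_leq_card/fsubsetP => p.
rewrite inE => /s_sub Hp; rewrite in_fset_set; last exact: finite_rep_pairs.
by apply/mem_set.
Qed.

(** The pair of indices i <= j behind a signed representation. *)
Definition unsign (z : int * int) : nat * nat :=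
  if (`|z.1| <= `|z.2|)%N then (`|z.1|%N, `|z.2|%N) else (`|z.2|%N, `|z.1|%N).

(** The representations are classified by the signs of their two entries, by
    which entry is larger in absolute value, and by the value of a_i + a_j,
    which lies in [N - 2 D, N + 2 D]. Within a class, [unsign] is injective. *)
Lemma exists_large_rep_count (a : nat -> nat) (N D m : nat)
    (l : seq (int * int)) :
  increasing_enum a -> uniq l -> {in l, forall z, sum_sq z = N%:Z} ->
  (forall v, (v ^ 2 != N)%N) ->
  (forall i, (0 < i)%N -> (i ^ 2 <= N)%N ->
    (i ^ 2 <= a i + D)%N /\ (a i <= i ^ 2 + D)%N) ->
  (8 * (4 * D).+1 * m < size l)%N ->
  exists n, (m < rep_count a n)%N.
Proof.
move=> a_incr l_uniq l_sum N_nsq a_near lt_size.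
have pos (z : int * int) : z \in l ->
    [/\ (0 < `|z.1|)%N, (0 < `|z.2|)%N & (`|z.1| ^ 2 + `|z.2| ^ 2 = N)%N].
  case: z => u v /l_sum; rewrite /sum_sq /= => E.
  have E' : (`|u| ^ 2 + `|v| ^ 2 = N)%N by move: E; clear; nia.
  split=> //; rewrite lt0n.
    by apply: contra_eq_neq E' => ->; rewrite exp0n // add0n N_nsq.
  by apply: contra_eq_neq E' => ->; rewrite exp0n // addn0 N_nsq.
pose shift z : nat := (a `|z.1| + a `|z.2| + 2 * D - N)%N.
have shift_ok z : z \in l ->
    (N <= a `|z.1| + a `|z.2| + 2 * D)%N /\ (shift z < (4 * D).+1)%N.
  case: z => u v /pos[/= u_gt0 v_gt0 E].
  have [||] := a_near `|u|%N; rewrite -?E ?leq_addr //.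
  have [||] := a_near `|v|%N; rewrite -?E ?leq_addl //.
  rewrite /shift /=; move: (`|u| ^ 2)%N (`|v| ^ 2)%N E; clear; lia.
pose key z : bool * bool * bool * 'I_(4 * D).+1 :=
  (0 <= z.1, 0 <= z.2, (`|z.1| <= `|z.2|)%N, inord (shift z)).
have [|[[[s1 s2] o] d]] := @pigeonhole_seq _ _ key l m.
  by rewrite !card_prod !card_bool card_ord.
rewrite -size_filter => lt_m; set l' := [seq z <- l | _] in lt_m.
have l'P z : z \in l' ->
    [/\ z \in l, (0 <= z.1) = s1, (0 <= z.2) = s2, (`|z.1| <= `|z.2|)%N = o
      & shift z = d].
  rewrite mem_filter => /andP[/eqP[<- <- <- <-] z_in].
  by split=> //; rewrite inordK //; case: (shift_ok z z_in).
exists (N + d - 2 * D)%N; apply: leq_trans lt_m _.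
rewrite -(size_map unsign); apply: rep_count_ge => //.
- rewrite map_inj_in_uniq ?filter_uniq // => -[u v] [u' v'].
  move=> /l'P[/= _ Eu Ev Eo _] /l'P[/= _ Eu' Ev' Eo' _].
  rewrite /unsign /= Eo Eo'; case: o {Eo Eo' l' l'P} => -[];
    by move: Eu' Ev'; rewrite -Eu -Ev; clear=> *; congr (_, _); lia.
- move=> p /mapP[[u v] /l'P[z_in _ _ _ <-] ->].
  have [/= u_gt0 v_gt0 _] := pos _ z_in; have [/= le_N _] := shift_ok _ z_in.
  rewrite /rep_pairs /unsign /shift /=; case: ifP => le_uv /=;
    split=> //; lia.
Qed.

(** * Comparing the deviation with the number of representations *)

Lemma ln2_ge_half (R : realType) : 2^-1 <= ln 2 :> R.
Proof.
have := @le_ln1Dx R (- 2^-1).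
rewrite (_ : 1 + - 2^-1 = 2^-1); last by field.
rewrite lnV ?posrE // lerN2; apply; lra.
Qed.

(** Since 4 x^2 + 1 <= (3 x)^2, every i <= sqrt N satisfies log i <= k w with
    w = log(3 x), and 2^x <= (3 x)^(2 k) gives
    k w >= (x log 2) / 2 >= (3 x) / 12, which is the lower bound for log(k w).
    Taking for x a square m^2 makes w <= 6 m, so that k >= m / 24 is
    unbounded. *)
Lemma number_with_many_signed_reps_log (R : realType) (W : R) :
  exists (k N : nat) (l : seq (int * int)) (w : R),
   [/\ W <= k%:R, W <= w /\ w - ln 12 <= ln (k%:R * w),
       forall i, (0 < i)%N -> (i ^ 2 <= N)%N -> ln i%:R <= k%:R * w,
       forall v, (v ^ 2 != N)%N & [/\ uniq l, size l = (2 ^ k)%N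
       & {in l, forall z, sum_sq z = N%:Z}]].
Proof.
(* expR W ensures w >= W, and 24 W ensures k >= W. *)
pose m := (Num.truncn (expR W + `|24 * W|)).+1.
have m_gt : expR W + `|24 * W| < m%:R by apply: truncnS_gt.
have m_ge1 : 1 <= m%:R :> R by rewrite ler1n.
have ln2 := ln2_ge_half R.
have [|k [N [l [le_k N_le N_nsq l_uniq [l_size l_sum]]]]] :=
  @number_with_many_signed_reps (m ^ 2); first by rewrite expn_gt0.
have y_le : (4 * (m ^ 2) ^ 2 + 1 <= (3 * m ^ 2) ^ 2)%N.
  have : (0 < (m ^ 2) ^ 2)%N by rewrite !expn_gt0.
  rewrite expnMn; move: ((m ^ 2) ^ 2)%N => q; lia.
have {}y_le : ((4 * (m ^ 2) ^ 2 + 1) ^ k <= ((3 * m ^ 2) ^ 2) ^ k)%N.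
  by case: (k) => // k'; rewrite leq_exp2r.
pose X : R := 3 * m%:R ^+ 2; pose w := ln X.
have XE : (3 * m ^ 2)%:R = X by rewrite natrM natrX.
have X_gt0 : 0 < X by rewrite /X; nra.
have X_ge1 : 1 <= X by rewrite /X; nra.
have w_ge0 : 0 <= w by apply: ln_ge0.
have x_le : m%:R ^+ 2 * ln 2 <= 2 * (k%:R * w).
  have : (2 ^ (m ^ 2) <= (3 * m ^ 2) ^ (2 * k))%N.
    by rewrite expnM; apply: leq_trans le_k _.
  rewrite -(ler_nat R) !natrX XE => le_X.
  have : ln (2 ^+ (m ^ 2)) <= ln (X ^+ (2 * k)).
    by rewrite ler_ln ?posrE ?exprn_gt0.
  rewrite !lnXn // -[_ *+ (m ^ 2)]mulr_natl -[_ *+ (2 * k)]mulr_natl.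
  by rewrite natrX natrM mulrA.
have kw_ge : X / 12 <= k%:R * w.
  have := ler_wpM2l (sqr_ge0 m%:R) ln2; rewrite /X; lra.
have w_le : w <= 6 * m%:R.
  have : w <= ln ((3 * m%:R) ^+ 2).
    by rewrite ler_ln ?posrE ?exprn_gt0 // /X; nra.
  rewrite lnXn; last by nra.
  have := @ln_sublinear R (3 * m%:R) _; rewrite -mulr_natl; nra.
exists k, N, l, w; split=> //; first 1 last.
- split.
    rewrite -(expRK W) /w ler_ln ?posrE ?expR_gt0 //.
    have := normr_ge0 (24 * W); rewrite /X; nra.
  have X12_gt0 : 0 < X / 12 by rewrite divr_gt0.
  by rewrite /w -ln_div ?posrE // ler_ln ?posrE // (lt_le_trans X12_gt0).
- move=> i i_gt0 i_le.
  have : (i ^ 2 <= ((3 * m ^ 2) ^ k) ^ 2)%N.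
    by rewrite expnAC; apply: leq_trans i_le (leq_trans N_le y_le).
  rewrite leq_exp2r // -(ler_nat R) natrX XE => i_leX.
  by rewrite mulr_natl -lnXn // ler_ln ?posrE ?exprn_gt0 // ltr0n.
- have := ler_norm (24 * W); have := expR_gt0 W; move=> h1 h2.
  have : m%:R ^+ 2 <= 24 * k%:R * m%:R :> R.
    have := ler_wpM2l (ler0n R k) w_le; move: kw_ge; rewrite /X; lra.
  rewrite expr2 ler_pM2r ?ltr0n // => h3.
  lra.
Qed.

Lemma ratio_ln_le (R : realType) (t T : R) : expR 1 <= t -> t <= T ->
  t / ln t <= T / ln T.
Proof.
move=> t_ge le_tT.
have t_gt0 : 0 < t := lt_le_trans (expR_gt0 1) t_ge.
have T_gt0 : 0 < T := lt_le_trans t_gt0 le_tT.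
have lnt_ge1 : 1 <= ln t by rewrite -(expRK 1) ler_ln ?posrE ?expR_gt0.
have lnT_ge1 : 1 <= ln T by apply: le_trans lnt_ge1 _; rewrite ler_ln.
rewrite ler_pdivlMr ?(lt_le_trans ltr01) //.
rewrite mulrAC ler_pdivrMr ?(lt_le_trans ltr01) //.
(* log(T / t) <= T / t - 1, which is at most (T / t - 1) log t. *)
have : ln T <= ln t + (T / t - 1).
  rewrite -lerBlDl -ln_div ?posrE //.
  have := @le_ln1Dx R (T / t - 1); rewrite [1 + _]addrC subrK; apply.
  by rewrite ltrBDl subrr divr_gt0.
rewrite -(ler_pM2l t_gt0) mulrDr mulrBr mulr1 mulrCA divff ?gt_eqF // mulr1.
nra.
Qed.

(** T / log T is at most k w / (w - L), and half of the loss e in the constant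
    absorbs the factor w / (w - L) once w is large. *)
Lemma exponent_bound (R : realType) (e c L w T k : R) :
  0 < e -> e < c -> 0 < L -> 2 * c * L / e <= w -> 0 <= k -> T = k * w ->
  w - L <= ln T -> (c - e) * (T / ln T) <= (c - e / 2) * k.
Proof.
move=> e_gt0 e_lt L_gt0; rewrite ler_pdivrMr // => w_ge k_ge0 -> ln_ge.
have w_gt : L < w by nra.
have lnT_gt0 : 0 < ln (k * w) by lra.
rewrite mulrA ler_pdivrMr //.
have h : (c - e) * w <= (c - e / 2) * (w - L) by nra.
have h2 : (c - e / 2) * (w - L) <= (c - e / 2) * ln (k * w).
  by rewrite ler_pM2l; lra.
have := ler_wpM2l k_ge0 (le_trans h h2); lra.
Qed.

(** Passing to a smaller e is harmless only where the exponent log n / log log n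
    is nonnegative; the bound expR 1 <= ln n ensures this, and it is also what
    [ratio_ln_le] asks for. *)
Lemma near_squares_bound (R : realType) (eps e : R) (a : nat -> nat) :
  e <= eps ->
  (fun n : nat => `|(a n)%:R - n%:R ^+ 2| : R^o) =O_\oo
    (fun n : nat =>
       expR ((ln 2 - eps) * (ln n%:R / ln (ln n%:R))) : R^o) ->
  exists (C : R) (n0 : nat), 0 < C /\ forall n, (n0 <= n)%N ->
    expR 1 <= ln n%:R :> R /\
    `|(a n)%:R - n%:R ^+ 2| <= C * expR ((ln 2 - e) * (ln n%:R / ln (ln n%:R))).
Proof.
move=> e_le /eqO_exP[C C_gt0 [n1 _ n1P]].
pose n2 := (Num.truncn (expR (expR 1 : R))).+1.
exists C, (maxn n1 n2); split=> // n; rewrite geq_max => /andP[n1_le n2_le].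
have lnn_ge : expR 1 <= ln n%:R :> R.
  rewrite -(expRK (expR 1)) ler_ln ?posrE ?expR_gt0 ?ltr0n //; last first.
    by apply: leq_trans n2_le.
  by apply: le_trans (ltW (truncnS_gt _)) _; rewrite ler_nat.
split=> //; have := n1P n n1_le; rewrite /= normr_id => /le_trans -> //.
rewrite ler_pM2l // ger0_norm ?expR_ge0 // ler_expR ler_wpM2r ?lerB //.
have lnn_gt0 : 0 < ln n%:R :> R := lt_le_trans (expR_gt0 1) lnn_ge.
have lnlnn_ge1 : 1 <= ln (ln n%:R) :> R.
  by rewrite -[X in X <= _](expRK 1) ler_ln ?posrE ?expR_gt0.
by rewrite divr_ge0 ?ltW // (lt_le_trans ltr01).
Qed.

Theorem theorem2 (R : realType) (eps : R) (eps_gt0 : 0 < eps)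
  (a : nat -> nat) (a_incr : increasing_enum a)
  (a_near_squares :
    (fun n : nat => `|(a n)%:R - n%:R ^+ 2| : R^o) =O_\oo
    (fun n : nat =>
       expR ((ln 2 - eps) * (ln n%:R / ln (ln n%:R))) : R^o)) :
  ~ (exists M : nat, forall n : nat, (rep_count a n <= M)%N).
Proof.
case=> M le_M.
have ln2_ge := ln2_ge_half R.
(* Any positive value below ln 2 would do in place of 1/4. *)
pose e := Num.min eps 4^-1.
have e_gt0 : 0 < e by rewrite lt_min eps_gt0 invr_gt0 ltr0n.
have e_le4 : e <= 4^-1 by rewrite ge_min lexx orbT.
have e_lt : e < ln 2 by lra.
have e_le : e <= eps by rewrite ge_min lexx.
have [C [n0 [C_gt0 a_near]]] := near_squares_bound e_le a_near_squares.
(* D0 takes care of the finitely many indices below n0. *)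
pose D0 := (\sum_(i < n0) (i ^ 2 + a i))%N.
(* K E bounds the number 8 (4 D + 1) M to be exceeded, where E is the common
   bound for the exponential factors below. *)
pose K : R := 8 * M%:R * (4 * D0%:R + 5 + 4 * C).
have L_gt0 : 0 < ln 12 :> R by apply: ln_gt0; lra.
have [k [N [l [w [W_le_k [W_le_w lnT_ge] i_le N_nsq l_props]]]]] :=
  number_with_many_signed_reps_log (`|2 * ln 2 * ln 12 / e| + `|2 * K / e|).
have [l_uniq l_size l_sum] := l_props.
have w_ge : 2 * ln 2 * ln 12 / e <= w.
  have := ler_norm (2 * ln 2 * ln 12 / e); have := normr_ge0 (2 * K / e); lra.
have k_ge : 2 * K / e <= k%:R.
  have := normr_ge0 (2 * ln 2 * ln 12 / e); have := ler_norm (2 * K / e); lra.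
pose T := k%:R * w.
pose E := expR ((ln 2 - e / 2) * k%:R).
have E_ge1 : 1 <= E by rewrite -expR0 ler_expR mulr_ge0 //; lra.
pose D := (D0 + (Num.truncn (C * E)).+1)%N.
have a_close i : (0 < i)%N -> (i ^ 2 <= N)%N ->
    (i ^ 2 <= a i + D)%N /\ (a i <= i ^ 2 + D)%N.
  move=> i_gt0 i2_le; have [i_lt|n0_le] := ltnP i n0.
    have : (i ^ 2 + a i <= D0)%N.
      by rewrite /D0 (bigD1 (Ordinal i_lt)) //= leq_addr.
    move/leq_trans/(_ (leq_addr (Num.truncn (C * E)).+1 _)); rewrite -/D.
    by move: (i ^ 2)%N (a i) (D); clear; lia.
  have [lni_ge dev_le] := a_near i n0_le.
  have le_CE : `|(a i)%:R - i%:R ^+ 2| <= C * E.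
    apply: le_trans dev_le _; rewrite ler_pM2l // ler_expR.
    apply: le_trans (_ : (ln 2 - e) * (T / ln T) <= _).
      by rewrite ler_pM2l ?subr_gt0 // ratio_ln_le // i_le.
    exact: (exponent_bound e_gt0 e_lt L_gt0 w_ge).
  have : `|(a i)%:R - i%:R ^+ 2| <= D%:R :> R.
    rewrite /D natrD; have := truncnS_gt (C * E); have := ler0n R D0; lra.
  rewrite ler_norml -natrX; move/andP => [h1 h2].
  by split; rewrite -(ler_nat R) natrD; lra.
have [|n] := exists_large_rep_count (m := M) a_incr l_uniq l_sum N_nsq a_close.
  rewrite l_size -(ltr_nat R) natrX -[2%:R](@lnK R) ?posrE // -expRM_natl.
  have D_le : D%:R <= D0%:R + 1 + C * E :> R.
    rewrite /D natrD -natr1.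
    have /truncn_itv/andP[] : 0 <= C * E by rewrite mulr_ge0 ?expR_ge0 ?ltW.
    lra.
  apply: le_lt_trans (_ : K * E < _).
    rewrite !natrM -[(4 * D).+1%:R]natr1 natrM /K.
    have le_E : 4 * D%:R + 1 <= (4 * D0%:R + 5 + 4 * C) * E.
      have : 4 * D0%:R + 5 <= (4 * D0%:R + 5) * E.
        by rewrite ler_peMr // addr_ge0 ?mulr_ge0 ?ler0n.
      lra.
    by rewrite mulrAC -[leRHS]mulrA ler_wpM2l // mulr_ge0 ?ler0n.
  rewrite (_ : k%:R * ln 2 = e / 2 * k%:R + (ln 2 - e / 2) * k%:R); last by lra.
  rewrite expRD ltr_pM2r ?expR_gt0 //.
  have := expR_ge1Dx (e / 2 * k%:R); move: k_ge; rewrite ler_pdivrMr //; lra.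
by rewrite ltnNge le_M.
Qed.
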